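(* Let $G$ be a finite group. Let $M_1$ be a cut cellular surface with $n$ in and $m$ out boundary components, let $M_2$ be a cut cellular surface with $p$ in and $q$ out boundary components, and let $M_1\sqcup M_2$ be their disjoint union. Then for all $g_1,\dots,g_n,h_1,\dots,h_m,g'_1,\dots,g'_p,h'_1,\dots,h'_q\in G$, $$\langle h_1,\dots,h_m,h'_1,\dots,h'_q|Z_{M_1\sqcup M_2}|g_1,\dots,g_n,g'_1,\dots,g'_p\rangle=\langle h_1,\dots,h_m|Z_{M_1}|g_1,\dots,g_n\rangle\cdot\langle h'_1,\dots,h'_q|Z_{M_2}|g'_1,\dots,g'_p\rangle .$$ Equivalently, $Z_{M_1\sqcup M_2}=Z_{M_1}\otimes Z_{M_2}$.
   Context: Cut cellular surfaces. A cut cellular surface (CCS) is an orientable 2-manifold $M$ with (possibly empty) boundary, endowed with a finite cell structure (0-, 1- and 2-cells), such that: (a) each boundary component of $M$ consists of a single 0-cell and a single 1-cell. (b) $M$ has a specified planar representation, obtained by cutting $M$ along 1-cells so as to obtain a simply connected region in the plane bounded by ''external'' 1-cells, namely the boundary 1-cells and the 1-cells along which $M$ was cut (''cut 1-cells''; each appears twice in the boundary of the planar region). The cut 1-cells are labelled and oriented to make explicit how they are identified in $M$. (c) The boundary components lie either along the bottom edge of the planar representation (the ''in'' components) or along the top edge (the ''out'' components); when there are no in (resp. out) components, the bottom (resp. top) edge is a single 0-cell. On the left side, on the right side, and between consecutive boundary components along the bottom and top edges there are one or more cut 1-cells, separated by 0-cells when there are more than one. (d) The planar region is made up of one or more 2-cells,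 separated by ''internal'' 1-cells and 0-cells. Colourings and invariant. Fix a finite group $G$. Orient the 1-cells of $M$: boundary 1-cells from left to right in the planar representation, cut 1-cells as specified in (b), internal 1-cells arbitrarily. A $G$-colouring of $M$ is an assignment of an element $g_i\in G$ to each 1-cell $i$ such that for each 2-cell in the planar representation, if the 1-cells of its boundary in anticlockwise order are $i_1,\dots,i_k$, then $\prod_{j=1}^k g_{i_j}^{\pm1}=1$ (flatness), where the exponent is $+1$ if the 1-cell $i_j$ is oriented compatibly with the positive (anticlockwise) orientation of the 2-cell, and $-1$ otherwise. Suppose $M$ has $n$ in and $m$ out boundary components, ordered from left to right. Let $\mathcal C(g_1,\dots,g_n;h_1,\dots,h_m)$ be the set of $G$-colourings of $M$ assigning $g_1,\dots,g_n$ to the in boundary components and $h_1,\dots,h_m$ to the out boundary components, and let $v$ be the number of internal vertices of $M$ (0-cells not lying on the boundary of $M$). The invariant is $$\langle h_1,\dots,h_m|Z_M|g_1,\dots,g_n\rangle:=\frac{1}{|G|^{\frac{m+n}{2}+v}}\,\#\mathcal C(g_1,\dots,g_n;h_1,\dots,h_m),$$ with an empty list written $\emptyset$ when there are no in (or out) components. $Z_M$ also denotes the linear map with these matrix elements between the real vector spaces with bases all $G$-colourings of the in boundary and all $G$-colourings of the out boundary respectively. Disjoint union. $M_1\sqcup M_2$ is the juxtaposition of the planar representations, with $M_1$ on the left and $M_2$ on the right, so that its in (resp. out) boundary components are those of $M_1$ followed by those of $M_2$. A $G$-colouring of $M_1\sqcup M_2$ and the invariant of $M_1\sqcup M_2$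 are defined in exactly the same way as for a single CCS (flatness being required for all 2-cells, and the normalization using the total numbers of boundary components and of internal vertices). *)

(* Defs.v *)
From HB Require Import structures.
From mathcomp Require Import all_boot all_order all_algebra fingroup.
From mathcomp Require Import reals exp.

(** * Cut cellular surfaces and their finite group invariant

    A planar cell complex is encoded by its oriented 1-cells ("darts"): every
    1-cell of the planar representation carries two darts, exchanged by [flip].
    The map [fnext] sends a dart to the following dart along the boundary of
    the face on its left, so the orbits of [fnext] are the boundaries of the
    2-cells, read anticlockwise, together with the boundary of the unbounded
    face (read clockwise as seen from the region).  Since [fnext x] starts
    where [x] ends, the darts issuing from a given 0-cell of the planar
    representation form an orbit of [fnext \o flip].                            *)

Set Implicit Arguments.
Unset Strict Implicit.
Unset Printing Implicit Defensive.

Import Order.TTheory GRing.Theory Num.Theory.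

Local Open Scope ring_scope.

(** A labelled planar diagram with [n] in and [m] out boundary components.
    There is no connectedness requirement here, so that a juxtaposition of
    planar representations is again such a diagram; the axioms characterizing
    a cut cellular surface are in [ccs] below.
    The elements of [cell1] are the 1-cells of the surface M itself: the two
    copies of a cut 1-cell have the same label. *)
Record diagram (n m : nat) := Diagram {
  dart : finType;
  flip : dart -> dart;
  fnext : dart -> dart;
  outer : pred dart;         (* darts with the unbounded face on their left *)
  cell1 : finType;
  lab : dart -> cell1;
  along : pred dart;         (* does the dart agree with the orientation of
                                the 1-cell of M that it runs along?         *)
  in_bd : n.-tuple dart;     (* boundary 1-cells, from left to right, as    *)
  out_bd : m.-tuple dart     (* darts with the region on their left         *)
}.

Section Cells.
Variables (n m : nat) (M : diagram n m).

Definition bdart : pred (dart M) := [pred x | (x \in in_bd M) || (x \in out_bd M)].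

(** Darts issuing from the same 0-cell of M: 0-cells of M are 0-cells of the
    planar representation, modulo the identification of the starting points
    of equally labelled darts running in the same direction. *)
Definition orig_step : rel (dart M) :=
  [rel x y | (y == fnext (flip x)) || (lab x == lab y) && (along x == along y)].

Definition same_orig : rel (dart M) := connect orig_step.

(** A 0-cell of M, as the set of darts issuing from it. *)
Definition cell0 : {set {set dart M}} :=
  [set [set y | same_orig x y] | x : dart M].

Definition on_boundary (V : {set dart M}) : bool :=
  [exists x in V, bdart x || bdart (flip x)].

Definition n_internal : nat := #|[set V in cell0 | ~~ on_boundary V]|.

End Cells.

(** The cells [b_1, ..., b_k] separated by the words [w_1, ..., w_(k-1)]. *)
Fixpoint interleave (T : Type) (bs : seq T) (ws : seq (seq T)) : seq T :=
  match bs, ws with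
  | b :: bs', w :: ws' => b :: w ++ interleave bs' ws'
  | _, _ => bs
  end.

(** [in_gaps] are the words of cut 1-cells between consecutive in components,
    from left to right; [out_gaps] those between consecutive out components,
    from right to left.  With [right_side] and [left_side] they give the
    anticlockwise reading [perimeter] of the polygon bounding the planar
    region, starting from its bottom left corner.  All these darts have the
    region on their left.

    Gluing sides of a polygon in pairs always yields a surface, which is
    orientable iff the two sides in each pair have opposite directions on the
    perimeter ([cut_orient]).  In such a surface the boundary circle through a
    boundary 1-cell consists of this 1-cell and one 0-cell iff the two
    endpoints of the 1-cell are identified ([bd_closed]). *)
Record ccs (n m : nat) := CCS {
  diag :> diagram n m;
  in_gaps : seq (seq (dart diag));
  right_side : seq (dart diag);
  out_gaps : seq (seq (dart diag));
  left_side : seq (dart diag);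
  perimeter := interleave (in_bd diag) in_gaps ++ right_side
            ++ interleave (seq.rev (out_bd diag)) out_gaps ++ left_side;
  cuts := flatten in_gaps ++ right_side ++ flatten out_gaps ++ left_side;
  is_cut := [pred x | (x \in cuts) || (flip x \in cuts)];
  (* the planar cell complex is connected, and planar by Euler's formula *)
  flipK : involutive (@flip _ _ diag);
  flip_neq : forall x : dart diag, flip x != x;
  fnext_inj : injective (@fnext _ _ diag);
  planar_connected : forall x y : dart diag,
    connect [rel u v | (v == flip u) || (v == fnext u)] x y;
  planar_euler :
    (fcard (@fnext _ _ diag \o @flip _ _ diag) (dart diag)
     + fcard (@fnext _ _ diag) (dart diag)
     = fcard (@flip _ _ diag) (dart diag) + 2)%N;
  (* the unbounded face is the exterior of a simple polygon: traversed with
     that face on the left, the perimeter is read backwards *)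
  perimeter_uniq : uniq perimeter;
  perimeter_cycle : fcycle (@fnext _ _ diag) [seq flip x | x <- seq.rev perimeter];
  outerE : forall x : dart diag, outer x = (flip x \in perimeter);
  perimeter_inner : forall x, x \in perimeter -> ~~ outer x;
  perimeter_simple : {in perimeter &, forall x y,
    fconnect (@fnext _ _ diag \o @flip _ _ diag) x y -> x = y};
  (* arrangement of the sides of the polygon *)
  in_gaps_size : size in_gaps = n.-1;
  out_gaps_size : size out_gaps = m.-1;
  in_gaps_cut : [::] \notin in_gaps;
  out_gaps_cut : [::] \notin out_gaps;
  right_side_cut : right_side != [::];
  left_side_cut : left_side != [::];
  (* labels and orientations *)
  lab_surj : forall i : cell1 diag, exists x : dart diag, lab x = i;
  lab_flip : forall x : dart diag, lab (flip x) = lab x;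
  along_flip : forall x : dart diag, along (flip x) = ~~ along x;
  lab_inj : forall x y : dart diag, lab x = lab y ->
    [\/ y = x, y = flip x | is_cut x /\ is_cut y];
  cut_twice : {in cuts, forall x, count [pred y | lab y == lab x] cuts = 2%N};
  cut_orient : {in cuts &, forall x y,
    lab x = lab y -> x != y -> along y = ~~ along x};
  in_along : forall x, x \in in_bd diag -> along x;
  out_along : forall x, x \in out_bd diag -> ~~ along x;
  bd_closed : forall x : dart diag, bdart x -> same_orig x (flip x)
}.

(** Juxtaposition, with the first diagram on the left. *)
Definition djunion (n m p q : nat) (M1 : diagram n m) (M2 : diagram p q) :
    diagram (n + p) (m + q) :=
  {| dart := (dart M1 + dart M2)%type;
     flip := fun x => match x with inl a => inl (flip a) | inr b => inr (flip b) end;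
     fnext := fun x => match x with inl a => inl (fnext a) | inr b => inr (fnext b) end;
     outer := fun x => match x with inl a => outer a | inr b => outer b end;
     cell1 := (cell1 M1 + cell1 M2)%type;
     lab := fun x => match x with inl a => inl (lab a) | inr b => inr (lab b) end;
     along := fun x => match x with inl a => along a | inr b => along b end;
     in_bd := [tuple of map inl (in_bd M1) ++ map inr (in_bd M2)];
     out_bd := [tuple of map inl (out_bd M1) ++ map inr (out_bd M2)] |}.

Section Invariant.
Variables (R : realType) (G : finGroupType).

Section Colourings.
Variables (n m : nat) (M : diagram n m).

Definition holonomy (c : {ffun cell1 M -> G}) (x : dart M) : G :=
  if along x then c (lab x) else ((c (lab x))^-1)%g.

(** Flatness does not depend on the dart at which one starts to read the
    boundary of a 2-cell; all starting points are considered. *)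
Definition flat (c : {ffun cell1 M -> G}) : bool :=
  [forall x : dart M, ~~ outer x ==>
    ((\prod_(y <- orbit (@fnext _ _ M) x) holonomy c y)%g == 1%g)].

Definition colourings (g : n.-tuple G) (h : m.-tuple G) :
    {set {ffun cell1 M -> G}} :=
  [set c | [&& flat c, map_tuple (fun x => c (lab x)) (in_bd M) == g
             & map_tuple (fun x => c (lab x)) (out_bd M) == h]].

(** The matrix element [<h|Z_M|g>]. *)
Definition Zcoef (h : m.-tuple G) (g : n.-tuple G) : R :=
  1 / (#|G|%:R `^ ((m + n)%:R / 2 + (n_internal M)%:R)) * #|colourings g h|%:R.

End Colourings.

(** The real vector space with basis the [G]-colourings of [n] circles: the
    basis vector of a colouring is its indicator function. *)
Definition cspace (n : nat) := {ffun n.-tuple G -> R^o}.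

Definition cbasis (n : nat) (g : n.-tuple G) : cspace n :=
  [ffun k => (k == g)%:R].

Definition Zmap (n m : nat) (M : diagram n m) (f : cspace n) : cspace m :=
  \sum_(g : n.-tuple G) f g *: (\sum_(h : m.-tuple G) Zcoef M h g *: cbasis h).

Fact Zmap_is_linear (n m : nat) (M : diagram n m) : linear (Zmap M).
Proof.
move=> a u v; rewrite scaler_sumr -big_split; apply: eq_bigr => g _ /=.
by rewrite !ffunE scalerDl scalerA.
Qed.

HB.instance Definition _ (n m : nat) (M : diagram n m) :=
  GRing.isLinear.Build R (cspace n) (cspace m) *:%R (Zmap M) (Zmap_is_linear M).

(** [cspace n] tensor [cspace p] is identified with [cspace (n + p)] so that
    [cbasis g] tensor [cbasis g'] is [cbasis] of the concatenation. *)
Definition vtens (n p : nat) (u : cspace n) (w : cspace p) : cspace (n + p) :=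
  [ffun k => u [tuple tnth k (lshift p i) | i < n]
           * w [tuple tnth k (rshift n j) | j < p]].

(** Tensor product of linear maps, defined on the basis vectors. *)
Definition tensmap (n m p q : nat) (A : {linear cspace n -> cspace m})
    (B : {linear cspace p -> cspace q}) (f : cspace (n + p)) : cspace (m + q) :=
  \sum_(g : n.-tuple G) \sum_(g' : p.-tuple G)
    f [tuple of g ++ g'] *: vtens (A (cbasis g)) (B (cbasis g')).

Fact tensmap_is_linear (n m p q : nat) (A : {linear cspace n -> cspace m})
    (B : {linear cspace p -> cspace q}) : linear (tensmap A B).
Proof.
move=> a u v; rewrite scaler_sumr -big_split; apply: eq_bigr => g _ /=.
rewrite scaler_sumr -big_split; apply: eq_bigr => g' _ /=.
by rewrite !ffunE scalerDl scalerA.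
Qed.

HB.instance Definition _ (n m p q : nat) (A : {linear cspace n -> cspace m})
    (B : {linear cspace p -> cspace q}) :=
  GRing.isLinear.Build R (cspace (n + p)) (cspace (m + q)) *:%R (tensmap A B)
    (tensmap_is_linear A B).

Lemma lsplit_cat (n p : nat) (g : n.-tuple G) (g' : p.-tuple G) :
  [tuple tnth [tuple of g ++ g'] (lshift p i) | i < n] = g.
Proof. by apply: eq_from_tnth => i; rewrite tnth_mktuple tnth_lshift. Qed.

Lemma rsplit_cat (n p : nat) (g : n.-tuple G) (g' : p.-tuple G) :
  [tuple tnth [tuple of g ++ g'] (rshift n j) | j < p] = g'.
Proof. by apply: eq_from_tnth => j; rewrite tnth_mktuple tnth_rshift. Qed.

Lemma cspaceE (n : nat) (u : cspace n) : u = \sum_g u g *: cbasis g.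
Proof.
apply/ffunP => k; rewrite sum_ffunE (bigD1 k) //= big1 => [|g gk].
  by rewrite !ffunE eqxx addr0 [RHS]mulr1.
by rewrite !ffunE eq_sym (negPf gk) [LHS]mulr0.
Qed.

(** The usual characterization of the tensor product of linear maps. *)
Lemma tensmapE (n m p q : nat) (A : {linear cspace n -> cspace m})
    (B : {linear cspace p -> cspace q}) (u : cspace n) (w : cspace p) :
  tensmap A B (vtens u w) = vtens (A u) (B w).
Proof.
apply/ffunP => k; rewrite [u in RHS]cspaceE [w in RHS]cspaceE !linear_sum !ffunE.
rewrite !sum_ffunE mulr_suml; apply: eq_bigr => g _.
rewrite sum_ffunE mulr_sumr; apply: eq_bigr => g' _.
by rewrite !linearZ !ffunE lsplit_cat rsplit_cat [LHS]mulrACA.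
Qed.

End Invariant.

(* Main.v *)
(** No dart of one diagram is linked to a dart of the other, so the orbits of
    [fnext] and the classes of [same_orig] in the juxtaposition are the images of
    those of the two diagrams.  Hence the internal vertices add up, and gluing two
    colourings is a bijection from pairs of flat colourings onto flat colourings;
    the exponents of [#|G|] add up as well. *)

Require Import Defs.
From mathcomp Require Import all_boot all_order all_algebra fingroup.
From mathcomp Require Import reals exp ring.

Set Implicit Arguments.
Unset Strict Implicit.
Unset Printing Implicit Defensive.

Import Order.TTheory GRing.Theory Num.Theory.

Local Open Scope ring_scope.

Section EmbeddedGraph.
Variables (T U : finType) (e : rel T) (e' : rel U) (f : T -> U).
Hypothesis e'_f : forall x y, e' (f x) (f y) = e x y.
Hypothesis e'_codom : forall x z, e' (f x) z -> z \in codom f.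

(** A path of [e'] starting in the image of [f] can never leave it, by [e'_codom], so it pulls back
    edge by edge. This serves both the classes of [same_orig] and the orbits of [fnext]. *)
Lemma connect_embed x :
  [set z | connect e' (f x) z] = f @: [set y | connect e x y].
Proof.
apply/setP=> z; rewrite inE; apply/idP/imsetP.
  case/connectP=> s + ->; elim: s x => [|u s IHs] x /=.
    by exists x; rewrite ?inE ?connect0.
  case/andP=> e'xu; have /codomP[v uE] := e'_codom e'xu.
  move: e'xu; rewrite uE e'_f => exv /IHs[y]; rewrite inE => vy ->.
  by exists y; rewrite ?inE ?(connect_trans (connect1 exv)).
case=> y; rewrite inE => /connectP[s + ->] ->.
elim: s x => [|u s IHs] x /=; first by rewrite connect0.
case/andP=> exu /IHs; apply: connect_trans.
by apply: connect1; rewrite e'_f.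
Qed.

End EmbeddedGraph.

(** Equality of lists, not just of sets, is required because the holonomy product over an orbit is
    noncommutative. The two lists have equal length since an injection preserves the cardinality of
    a connected class. *)
Lemma orbit_embed (T U : finType) (f : T -> T) (f' : U -> U) (i : T -> U) x :
  injective i -> (forall y, f' (i y) = i (f y)) ->
  orbit f' (i x) = [seq i y | y <- orbit f x].
Proof.
move=> i_inj f'i.
have order_cards (V : finType) (k : V -> V) y :
    fingraph.order k y = #|[set z | connect (frel k) y z]|.
  by apply: eq_card => z; rewrite inE.
have imE : [set z | connect (frel f') (i x) z] = i @: [set y | connect (frel f) x y].
  apply: (@connect_embed _ _ (frel f) (frel f') i) => [y z | y z /= /eqP <-].
    by rewrite /= f'i (inj_eq i_inj).
  by rewrite f'i codom_f.
have orderE : fingraph.order f' (i x) = fingraph.order f x.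
  by rewrite !order_cards imE card_imset.
(* Once the common length is generalised, the orbits are plain trajectories, which [i] matches term
   by term. *)
rewrite /orbit orderE; move: (fingraph.order f x) => k.
elim: k x {imE orderE} => //= k IHk x.
by rewrite f'i IHk.
Qed.

(** Used to turn a sum over boundary colourings of the juxtaposition into a double sum, and to write
    any such colouring as a concatenation. *)
Lemma tuple_cat_bij (T : Type) (n p : nat) :
  bijective (fun u : n.-tuple T * p.-tuple T => [tuple of u.1 ++ u.2]).
Proof.
exists (fun k => ([tuple tnth k (lshift p i) | i < n],
                  [tuple tnth k (rshift n j) | j < p])).
  by case=> g g'; congr (_, _); apply: eq_from_tnth => i;
     rewrite tnth_mktuple ?tnth_lshift ?tnth_rshift.
move=> k; apply: eq_from_tnth => i; case: (split_ordP i) => j ->.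
  by rewrite tnth_lshift tnth_mktuple.
by rewrite tnth_rshift tnth_mktuple.
Qed.

Section Union.
Variables (n m p q : nat) (M1 : diagram n m) (M2 : diagram p q).
Let M := djunion M1 M2.
Let il : dart M1 -> dart M := inl.
Let ir : dart M2 -> dart M := inr.

Let il_inj : injective il := inl_inj.
Let ir_inj : injective ir := inr_inj.

(** [fnext] and [flip] preserve the summand and labels from different summands differ, so an
    [orig_step] across the summands computes to [false]. *)
Lemma same_orig_inl x :
  [set z | same_orig (il x) z] = il @: [set y | same_orig x y].
Proof.
by apply: connect_embed => // {}x; case=> [y _|//]; exact: codom_f.
Qed.

Lemma same_orig_inr x :
  [set z | same_orig (ir x) z] = ir @: [set y | same_orig x y].
Proof.
by apply: connect_embed => // {}x; case=> [//|y _]; exact: codom_f.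
Qed.

Lemma bdart_inl x : bdart (il x) = bdart x.
Proof.
rewrite /bdart /= !mem_cat !(mem_map il_inj).
have noR (s : seq (dart M2)) : (il x \in map inr s) = false by apply/mapP=> -[].
by rewrite !noR !orbF.
Qed.

Lemma bdart_inr x : bdart (ir x) = bdart x.
Proof.
rewrite /bdart /= !mem_cat !(mem_map ir_inj).
have noL (s : seq (dart M1)) : (ir x \in map inl s) = false by apply/mapP=> -[].
by rewrite !noL.
Qed.

Lemma on_boundary_inl (V : {set dart M1}) : on_boundary (il @: V) = on_boundary V.
Proof.
apply/exists_inP/exists_inP=> [[_ /imsetP[x Vx ->]]|[x Vx bx]].
  (* The argument is explicit because [flip (il x)] is only convertible to [il (flip x)]. *)
  by rewrite bdart_inl (bdart_inl (flip x)); exists x.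
by exists (il x); rewrite ?imset_f // bdart_inl (bdart_inl (flip x)).
Qed.

Lemma on_boundary_inr (V : {set dart M2}) : on_boundary (ir @: V) = on_boundary V.
Proof.
apply/exists_inP/exists_inP=> [[_ /imsetP[x Vx ->]]|[x Vx bx]].
  by rewrite bdart_inr (bdart_inr (flip x)); exists x.
by exists (ir x); rewrite ?imset_f // bdart_inr (bdart_inr (flip x)).
Qed.

Lemma cell0_djunion :
  cell0 M = [set il @: V | V : {set dart M1} in cell0 M1]
        :|: [set ir @: V | V : {set dart M2} in cell0 M2].
Proof.
apply/setP=> V; rewrite inE; apply/imsetP/orP.
- case=> -[x|x] _ ->; [left | right]; apply/imsetP.
    by exists [set y | same_orig x y]; rewrite ?same_orig_inl ?imset_f.
  by exists [set y | same_orig x y]; rewrite ?same_orig_inr ?imset_f.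
- case=> /imsetP[_ /imsetP[x _ ->] ->].
    by exists (il x); rewrite ?same_orig_inl.
  by exists (ir x); rewrite ?same_orig_inr.
Qed.

Lemma n_internal_djunion : n_internal M = (n_internal M1 + n_internal M2)%N.
Proof.
rewrite /n_internal.
set A := [set V in cell0 M1 | _]; set B := [set V in cell0 M2 | _].
pose A' := [set il @: V | V : {set dart M1} in A].
pose B' := [set ir @: V | V : {set dart M2} in B].
rewrite -(card_imset A (imset_inj il_inj)) -(card_imset B (imset_inj ir_inj)).
rewrite -/A' -/B'.
(* Only the empty set could be an image under both injections, and a 0-cell contains the dart that
   defines it. *)
have AB : A' :&: B' = set0.
  apply/setP=> V; rewrite !inE; apply/andP=> -[/imsetP[W WA ->] /imsetP[W' _ WW']].
  move: WA; rewrite inE => /andP[/imsetP[x _ WE] _].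
  have : il x \in il @: W by rewrite imset_f // WE inE /same_orig connect0.
  by rewrite WW' => /imsetP[].
have -> : [set V in cell0 M | ~~ on_boundary V] = A' :|: B'.
  apply/setP=> V; rewrite cell0_djunion !inE.
  apply/andP/orP=> [[/orP[]/imsetP[W W0 ->]]|[]/imsetP[W + ->]].
  - by rewrite on_boundary_inl => Wi; left; rewrite imset_f // inE W0.
  - by rewrite on_boundary_inr => Wi; right; rewrite imset_f // inE W0.
  - by rewrite inE on_boundary_inl => /andP[W0 ->]; rewrite imset_f.
  - by rewrite inE on_boundary_inr => /andP[W0 ->]; rewrite [X in _ || X]imset_f ?orbT.
by rewrite cardsU AB cards0 subn0.
Qed.

Section Colour.
Variables (R : realType) (G : finGroupType).

Definition glue (u : {ffun cell1 M1 -> G} * {ffun cell1 M2 -> G}) :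
    {ffun cell1 M -> G} :=
  [ffun i => match i with inl a => u.1 a | inr b => u.2 b end].

Lemma glue_inj : injective glue.
Proof.
move=> [c d] [c' d'] /ffunP E; congr (_, _); apply/ffunP=> i.
  by have := E (inl i); rewrite !ffunE.
by have := E (inr i); rewrite !ffunE.
Qed.

Lemma glue_surj c : exists u, c = glue u.
Proof.
exists ([ffun i => c (inl i)], [ffun i => c (inr i)]).
by apply/ffunP=> -[i|i]; rewrite !ffunE.
Qed.

(** The boundary of a 2-cell stays in the summand of its starting dart, where [glue u] restricts to
    one component of [u]. *)
Lemma flat_glue u : flat (glue u) = flat u.1 && flat u.2.
Proof.
have prodl x : (\prod_(y <- orbit (@fnext _ _ M) (il x)) holonomy (glue u) y
     = \prod_(y <- orbit (@fnext _ _ M1) x) holonomy u.1 y)%g.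
  rewrite (@orbit_embed _ _ (@fnext _ _ M1) _ il) // big_map.
  by apply: eq_bigr => y _; rewrite /holonomy /= !ffunE.
have prodr x : (\prod_(y <- orbit (@fnext _ _ M) (ir x)) holonomy (glue u) y
     = \prod_(y <- orbit (@fnext _ _ M2) x) holonomy u.2 y)%g.
  rewrite (@orbit_embed _ _ (@fnext _ _ M2) _ ir) // big_map.
  by apply: eq_bigr => y _; rewrite /holonomy /= !ffunE.
apply/forallP/andP=> [H|[/forallP H1 /forallP H2] [x|x]].
- split; apply/forallP=> x.
    by rewrite -prodl; exact: (H (il x)).
  by rewrite -prodr; exact: (H (ir x)).
- by rewrite (prodl x); exact: H1.
- by rewrite (prodr x); exact: H2.
Qed.

Lemma colourings_djunion (g : n.-tuple G) (h : m.-tuple G)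
    (g' : p.-tuple G) (h' : q.-tuple G) :
  colourings M [tuple of g ++ g'] [tuple of h ++ h']
  = glue @: setX (colourings M1 g h) (colourings M2 g' h').
Proof.
apply/setP=> c; have [u ->] := glue_surj c.
rewrite (mem_imset _ _ glue_inj) !inE flat_glue -!val_eqE /= !map_cat -!map_comp.
have El (s : seq (dart M1)) :
    map ((fun x : dart M => glue u (lab x)) \o il) s = map (fun x => u.1 (lab x)) s.
  by apply: eq_map => x /=; rewrite ffunE.
have Er (s : seq (dart M2)) :
    map ((fun x : dart M => glue u (lab x)) \o ir) s = map (fun x => u.2 (lab x)) s.
  by apply: eq_map => x /=; rewrite ffunE.
(* The boundary conditions split because the left blocks have matching lengths, [n] for the in
   components and [m] for the out components. Only a reordering of six conjuncts then remains. *)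
rewrite !El !Er !eqseq_cat ?size_map ?size_tuple //.
by rewrite -!andbA; do !bool_congr.
Qed.

Lemma Zcoef_djunion (g : n.-tuple G) (h : m.-tuple G)
    (g' : p.-tuple G) (h' : q.-tuple G) :
  Zcoef R M [tuple of h ++ h'] [tuple of g ++ g'] = Zcoef R M1 h g * Zcoef R M2 h' g'.
Proof.
rewrite /Zcoef colourings_djunion (card_imset _ glue_inj) cardsX n_internal_djunion.
have -> : (m + q + (n + p))%:R / 2 + (n_internal M1 + n_internal M2)%:R
    = ((m + n)%:R / 2 + (n_internal M1)%:R)
      + ((q + p)%:R / 2 + (n_internal M2)%:R) :> R by rewrite !natrD; ring.
(* Splitting the power requires a nonzero base in case the total exponent vanishes; [G] contains
   [1], so its order is positive. *)
rewrite powRD; last first.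
  by apply/implyP=> _; rewrite pnatr_eq0 -lt0n; apply/card_gt0P; exists 1%g.
by rewrite natrM !div1r invfM mulrACA.
Qed.

End Colour.
End Union.

Section Maps.
Variables (R : realType) (G : finGroupType).

(** Evaluation at [k] kills every basis vector except [cbasis k], which leaves a matrix-vector
    product. *)
Lemma ZmapE n m (M : diagram n m) (f : cspace R G n) k :
  Zmap M f k = \sum_g f g * Zcoef R M k g.
Proof.
rewrite sum_ffunE; apply: eq_bigr => g _; rewrite !ffunE; congr (_ * _).
rewrite sum_ffunE (bigD1 k) //= big1 ?addr0 => [|h hk]; rewrite !ffunE.
  by rewrite eqxx [LHS]mulr1.
by rewrite eq_sym (negPf hk) [LHS]mulr0.
Qed.

Lemma Zmap_cbasis n m (M : diagram n m) (g : n.-tuple G) k :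
  Zmap M (cbasis R g) k = Zcoef R M k g.
Proof.
rewrite ZmapE (bigD1 g) //= big1 ?addr0 => [|h hg]; rewrite ffunE.
  by rewrite eqxx mul1r.
by rewrite (negPf hg) mul0r.
Qed.

End Maps.

Theorem mainTheorem4 (R : realType) (G : finGroupType) (n m p q : nat)
    (M1 : ccs n m) (M2 : ccs p q) :
  (forall (g : n.-tuple G) (h : m.-tuple G) (g' : p.-tuple G) (h' : q.-tuple G),
     Zcoef R (djunion M1 M2) [tuple of h ++ h'] [tuple of g ++ g']
     = Zcoef R M1 h g * Zcoef R M2 h' g') /\
  (forall f : cspace R G (n + p),
     Zmap (djunion M1 M2) f = tensmap (@Zmap R G n m M1) (@Zmap R G p q M2) f).
Proof.
split=> [g h g' h'|f]; first exact: Zcoef_djunion.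
apply/ffunP=> k; rewrite ZmapE.
rewrite (reindex _ (onW_bij _ (tuple_cat_bij G n p))) /=.
rewrite -(pair_bigA _ (fun (g : n.-tuple G) (g' : p.-tuple G) => f [tuple of g ++ g']
  * Zcoef R (djunion M1 M2) k [tuple of g ++ g'])) /=.
rewrite sum_ffunE; apply: eq_bigr => g _; rewrite sum_ffunE; apply: eq_bigr => g' _.
(* The output index [k] must also be split as [h ++ h'] before the matrix element factors. *)
have [cat' _ catK] := tuple_cat_bij G m q.
rewrite -(catK k); case: (cat' k) => h h' /=.
by rewrite Zcoef_djunion !ffunE lsplit_cat rsplit_cat !Zmap_cbasis.
Qed.
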